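(* Let $A\in\mathbb{R}^{m\times n}$ be semi-monotone, let $A=P_1-R_1+S_1$ be a double proper weak regular splitting and $A=P_2-R_2+S_2$ a double proper regular splitting of $A$. Suppose $N(S_2)\supseteq N(P_2)$, $R(S_2)\subseteq R(P_2)$, $1\notin\sigma(S_2P_1^{\dagger})$ and $\widehat{A}^{\dagger}\geq 0$, where $\widehat{A}=(I-S_2P_1^{\dagger})A$. If $P_1^{\dagger}\leq P_2^{\dagger}$ and $P_1^{\dagger}R_1\leq P_2^{\dagger}R_2$, then $\rho(W_{12})\leq\rho(T_1)<1$, where $$W_{12}=\begin{pmatrix} P_2^{\dagger}R_2-P_2^{\dagger}S_2P_1^{\dagger}R_1 & P_2^{\dagger}S_2P_1^{\dagger}S_1\\ I & 0\end{pmatrix},\qquad T_1=\begin{pmatrix} P_1^{\dagger}R_1 & -P_1^{\dagger}S_1\\ I&0\end{pmatrix}.$$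
   Context: For $M\in\mathbb{R}^{m\times n}$, $M^{\dagger}$ is its Moore–Penrose inverse, $R(M)$, $N(M)$ its range and null space; inequalities are entrywise; $\rho$ is the spectral radius, $\sigma$ the spectrum. $A$ is semi-monotone if $A^{\dagger}\geq 0$. A double splitting $A=P-R+S$ is a double proper splitting if $R(P)=R(A)$ and $N(P)=N(A)$; it is double proper regular if moreover $P^{\dagger}\geq0$, $R\geq0$, $S\leq0$; double proper weak regular if moreover $P^{\dagger}\geq 0$, $P^{\dagger}R\geq 0$, $P^{\dagger}S\leq 0$. *)

(* Defs.v *)
From HB Require Import structures.
From mathcomp Require Import all_boot all_order all_algebra.
From mathcomp Require Import complex.
From mathcomp Require Import classical_sets reals.
Set Implicit Arguments. Unset Strict Implicit. Unset Printing Implicit Defensive.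
Import Order.TTheory GRing.Theory Num.Theory.
Local Open Scope ring_scope.

Section Defs.
Variable R : realType.

Definition is_MP_inverse (m n : nat) (A : 'M[R]_(m, n)) (X : 'M[R]_(n, m)) : Prop :=
  [/\ A *m X *m A = A, X *m A *m X = X,
      (A *m X)^T = A *m X & (X *m A)^T = X *m A].

Definition mx_range (m n : nat) (A : 'M[R]_(m, n)) : set 'cV[R]_m :=
  [set y | exists x : 'cV[R]_n, y = A *m x].
Definition mx_null (m n : nat) (A : 'M[R]_(m, n)) : set 'cV[R]_n :=
  [set x | A *m x = 0].

Definition mx_le (m n : nat) (A B : 'M[R]_(m, n)) : Prop :=
  forall i j, A i j <= B i j.

Definition spectrum (n : nat) (M : 'M[R]_n) : set R[i] :=
  [set z | eigenvalue (map_mx (fun x : R => x%:C%C) M) z].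

(* spectral radius: largest modulus of an eigenvalue (sup of the finite set) *)
Definition spectral_radius (n : nat) (M : 'M[R]_n) : R :=
  sup [set ComplexField.Normc.normc z | z in spectrum M].

Definition double_proper_splitting (m n : nat) (A P Q S : 'M[R]_(m, n)) : Prop :=
  A = P - Q + S /\ mx_range P = mx_range A /\ mx_null P = mx_null A.

Definition double_proper_regular (m n : nat) (A P Q S : 'M[R]_(m, n))
  (Pd : 'M[R]_(n, m)) : Prop :=
  [/\ double_proper_splitting A P Q S, is_MP_inverse P Pd,
      mx_le 0 Pd, mx_le 0 Q & mx_le S 0].

Definition double_proper_weak_regular (m n : nat) (A P Q S : 'M[R]_(m, n))
  (Pd : 'M[R]_(n, m)) : Prop :=
  [/\ double_proper_splitting A P Q S, is_MP_inverse P Pd,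
      mx_le 0 Pd, mx_le 0 (Pd *m Q) & mx_le (Pd *m S) 0].

End Defs.

(* Main.v *)
(** Write B_i = P_i^+ R_i and C_i = - P_i^+ S_i, so that T1 y = t y reads
    t^2 y = t B1 y + C1 y for the lower block y.  A nonnegative matrix has
    spectral radius below t if and only if it has a strictly positive strict
    supersolution at level t.  The vector A^+ 1 gives such a supersolution for
    T1 at a level below 1.

    For t in (rho(T1), 1), one solves t^2 y = t B2 y + C2 y + P2^+ 1 with
    y >= 0: the solution is y = A^+ 1 at t = 1, and it continues down to any
    such t because B1 <= B2 and P1^+ <= P2^+ force
    t^2 y <= t B1 y + C1 y + P2^+ 1, which bounds y by a supersolution of T1.
    Regularity of the second splitting makes A y nonnegative modulo N(P2^+),
    so t B1 y + C1 y <= B1 y + C1 y = y - P1^+ A y <= y.  Inserted in the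
    second half step this shows that (t y, y) is a supersolution of W12 at
    level t. *)

Require Import Defs.
From HB Require Import structures.
From mathcomp Require Import all_boot all_order all_algebra.
From mathcomp Require Import complex.
From mathcomp Require Import boolp classical_sets reals.
From mathcomp Require Import polyrcf ring lra.
Import Order.TTheory GRing.Theory Num.Theory.
Local Open Scope ring_scope.
Local Open Scope classical_set_scope.

Set Implicit Arguments.
Unset Strict Implicit.
Unset Printing Implicit Defensive.

(** * Entrywise order and positive supersolutions *)

Definition mx_lt (R : realType) (m n : nat) (A B : 'M[R]_(m, n)) : Prop :=
  forall i j, A i j < B i j.

Section EntrywiseOrder.
Variable R : realType.

Lemma mx_ltW m n (A B : 'M[R]_(m, n)) : mx_lt A B -> mx_le A B.
Proof. by move=> AB i j; apply/ltW. Qed.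

Lemma mulmx_ge0 m n p (A : 'M[R]_(m, n)) (B : 'M[R]_(n, p)) :
  mx_le 0 A -> mx_le 0 B -> mx_le 0 (A *m B).
Proof.
move=> A0 B0 i j; rewrite !mxE sumr_ge0 // => k _.
by rewrite mulr_ge0 //; [have := A0 i k | have := B0 k j]; rewrite mxE.
Qed.

Lemma mx_subr_ge0 m n (A B : 'M[R]_(m, n)) : mx_le 0 (B - A) <-> mx_le A B.
Proof. by split=> AB i j; have := AB i j; rewrite !mxE subr_ge0. Qed.

Lemma mx_le_trans m n (B A C : 'M[R]_(m, n)) :
  mx_le A B -> mx_le B C -> mx_le A C.
Proof. by move=> AB BC i j; apply: le_trans (AB i j) (BC i j). Qed.

Lemma mx_leD m n (A B C D : 'M[R]_(m, n)) :
  mx_le A B -> mx_le C D -> mx_le (A + C) (B + D).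
Proof. by move=> AB CD i j; rewrite !mxE lerD. Qed.

Lemma mx_addr_ge0 m n (A B : 'M[R]_(m, n)) :
  mx_le 0 A -> mx_le 0 B -> mx_le 0 (A + B).
Proof. by move=> A0 B0; rewrite -[0]addr0; apply: mx_leD. Qed.

Lemma mx_scaler_ge0 m n (a : R) (A : 'M[R]_(m, n)) :
  0 <= a -> mx_le 0 A -> mx_le 0 (a *: A).
Proof.
by move=> a0 A0 i j; have := A0 i j; rewrite !mxE => ?; apply: mulr_ge0.
Qed.

Lemma mx_oppr_ge0 m n (A : 'M[R]_(m, n)) : mx_le A 0 -> mx_le 0 (- A).
Proof. by move=> A0 i j; have := A0 i j; rewrite !mxE oppr_ge0. Qed.

Lemma mulmx_le m n p (A : 'M[R]_(m, n)) (B C : 'M[R]_(n, p)) :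
  mx_le 0 A -> mx_le B C -> mx_le (A *m B) (A *m C).
Proof.
by move=> A0 BC; apply/mx_subr_ge0; rewrite -mulmxBr; apply/mulmx_ge0/mx_subr_ge0.
Qed.

Lemma mulmx_le_r m n p (A B : 'M[R]_(m, n)) (C : 'M[R]_(n, p)) :
  mx_le A B -> mx_le 0 C -> mx_le (A *m C) (B *m C).
Proof.
move=> AB C0; apply/mx_subr_ge0; rewrite -mulmxBl; apply: mulmx_ge0 => //.
exact/mx_subr_ge0.
Qed.

(** The sum of the ratios [|b i| / d i] dominates each of them, so the inverse of one plus this sum
    works for all indices at once, even when [I] is empty. *)
Lemma exists_small_scale (I : finType) (b d : I -> R) :
  (forall i, 0 < d i) -> exists2 e, 0 < e & forall i, e * b i < d i.
Proof.
move=> d0; pose s := \sum_i `|b i| / d i.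
have s0 : 0 <= s by apply: sumr_ge0 => i _; rewrite divr_ge0 // ltW.
exists (1 + s)^-1; first by rewrite invr_gt0; lra.
move=> i; rewrite mulrC ltr_pdivrMr; last by lra.
have : `|b i| / d i <= s.
  by rewrite /s (bigD1 i) //= lerDl sumr_ge0 // => j _; rewrite divr_ge0 // ltW.
rewrite ler_pdivrMr // => bs; have := ler_norm (b i); have := d0 i; nra.
Qed.

(* An index [i] minimizing [x i / w i] would violate the inequality if [x i < 0]. *)
Lemma min_principle n (M : 'M[R]_n) (s : R) (w x : 'cV[R]_n) :
  mx_le 0 M -> mx_lt 0 w -> mx_lt (M *m w) (s *: w) ->
  mx_le (M *m x) (s *: x) -> mx_le 0 x.
Proof.
move=> M0 w0 Mw Mx i0 j0; rewrite (ord1 j0) mxE leNgt; apply/negP => xi0.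
have w0' i : 0 < w i 0 by have := w0 i 0; rewrite mxE.
case: (Order.TotalTheory.arg_minP (fun i => x i 0 / w i 0) (isT : xpredT i0)).
move=> i _ /(_ _ isT) imin; set c := x i 0 / w i 0 in imin.
have xi : x i 0 = c * w i 0 by rewrite /c divfK // gt_eqF.
have c0 : c < 0.
  by apply: le_lt_trans (imin i0) _; rewrite ltr_pdivrMr ?mul0r.
have : mx_le (M *m (c *: w)) (M *m x).
  apply: mulmx_le => // k j; rewrite (ord1 j) !mxE -ler_pdivlMr //; exact: imin.
move=> /(_ i 0); have := Mx i 0; have := Mw i 0.
have sc (a : R) (u : 'cV[R]_n) : (a *: u) i 0 = a * u i 0 by rewrite mxE.
rewrite -scalemxAr !sc xi; set p := (M *m w) i 0; set q := (M *m x) i 0; nra.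
Qed.

(** Adding a small multiple of the all-ones vector makes [y] positive. Where the inequality is
    strict, the slack absorbs the perturbation; in a zero row the left side stays 0. *)
Lemma exists_pos_supersolution n (M : 'M[R]_n) (s : R) (y : 'cV[R]_n) :
  mx_le 0 M -> 0 < s -> mx_le 0 y ->
  (forall i, (M *m y) i 0 < s * y i 0 \/ row i M = 0) ->
  exists2 y' : 'cV[R]_n, mx_lt 0 y' & mx_lt (M *m y') (s *: y').
Proof.
move=> M0 s0 y0 My; pose o : 'cV[R]_n := const_mx 1.
(* The value 1 in zero rows is an arbitrary positive placeholder. *)
pose d i := if row i M == 0 then 1 else s * y i 0 - (M *m y) i 0.
have d0 i : 0 < d i by rewrite /d; case: eqP => //; case: (My i) => //; rewrite subr_gt0.
have [e e0 eP] := exists_small_scale (fun i => (M *m o) i 0) d0.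
have y0' i : 0 <= y i 0 by have := y0 i 0; rewrite mxE.
exists (y + e *: o) => i j; rewrite (ord1 j); first by rewrite !mxE; have := y0' i; lra.
have sc (a : R) (u : 'cV[R]_n) : (a *: u) i 0 = a * u i 0 by rewrite mxE.
have ad (u v : 'cV[R]_n) : (u + v) i 0 = u i 0 + v i 0 by rewrite mxE.
have -> : (s *: (y + e *: o)) i 0 = s * (y i 0 + e) by rewrite sc ad sc [o i 0]mxE mulr1.
rewrite mulmxDr -scalemxAr ad sc.
have := eP i; rewrite /d; case: eqP => [ri _|_]; last by have := y0' i; nra.
have rz (u : 'cV[R]_n) : (M *m u) i 0 = 0.
  have -> : (M *m u) i 0 = (row i M *m u) 0 0 by rewrite -row_mul [RHS]mxE.
  by rewrite ri mul0mx mxE.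
by rewrite !rz mulr0 addr0 mulr_gt0 //; have := y0' i; lra.
Qed.

Lemma mx_le_col m1 m2 p (a c : 'M[R]_(m1, p)) (b d : 'M[R]_(m2, p)) :
  mx_le a c -> mx_le b d -> mx_le (col_mx a b) (col_mx c d).
Proof. by move=> ac bd i j; rewrite !mxE; case: split. Qed.

Lemma mx_lt_col m1 m2 p (a c : 'M[R]_(m1, p)) (b d : 'M[R]_(m2, p)) :
  mx_lt (col_mx a b) (col_mx c d) -> mx_lt a c /\ mx_lt b d.
Proof.
move=> h; split=> i j; first by have := h (lshift _ i) j; rewrite !col_mxEu.
by have := h (rshift _ i) j; rewrite !col_mxEd.
Qed.

(** A nonnegative row with zero sum vanishes, and so does the same row of every product with [Q] on
    the left. This supplies the dichotomy required by [exists_pos_supersolution] for matrices that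
    factor through [Q]. *)
Lemma row0_or_pos p m q (Q : 'M[R]_(m, p)) i (N : 'M[R]_(p, q)) :
  mx_le 0 Q -> 0 < (Q *m const_mx 1 : 'cV[R]_m) i 0 \/ row i (Q *m N) = 0.
Proof.
move=> Q0; have Q0' j : 0 <= Q i j by have := Q0 i j; rewrite mxE.
have oE : (Q *m const_mx 1 : 'cV[R]_m) i 0 = \sum_j Q i j.
  by rewrite mxE; apply: eq_bigr => j _; rewrite mxE mulr1.
have : 0 <= \sum_j Q i j by apply: sumr_ge0.
rewrite oE le_eqVlt => /orP[/eqP/esym Qi|]; [right|by left].
have /allP Qij : all (fun j => Q i j == 0) (index_enum 'I_p).
  by move/eqP: Qi; rewrite psumr_eq0.
rewrite row_mul (_ : row i Q = 0) ?mul0mx //.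
by apply/rowP => j; rewrite !mxE; apply/eqP/Qij; rewrite mem_index_enum.
Qed.

(** The minimum principle is used twice: applied to a null vector and to its opposite it makes
    [s%:M - M] invertible, and applied to the solution it gives the sign. *)
Lemma resolvent_solution n (M : 'M[R]_n) (s : R) (w v : 'cV[R]_n) :
  mx_le 0 M -> mx_lt 0 w -> mx_lt (M *m w) (s *: w) -> mx_le 0 v ->
  exists2 y, mx_le 0 y & s *: y = M *m y + v.
Proof.
move=> M0 w0 Mw v0; have solE y : (s%:M - M) *m y = s *: y - M *m y.
  by rewrite mulmxBl mul_scalar_mx.
have U : s%:M - M \in unitmx.
  (* [det0P] yields a left null vector, hence the passage to the transpose. *)
  rewrite -unitmx_tr unitmxE unitfE; apply/negP => /det0P[x x0 /(congr1 trmx)].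
  rewrite trmx_mul trmxK trmx0 solE => /eqP; rewrite subr_eq0 => /eqP sx.
  have xP : mx_le 0 x^T by apply: (min_principle M0 w0 Mw); rewrite sx.
  have xN : mx_le 0 (- x^T).
    by apply: (min_principle M0 w0 Mw); rewrite mulmxN scalerN sx.
  case/eqP: x0; apply/rowP => j; have := xP j 0; have := xN j 0; rewrite !mxE.
  by move=> ? ?; lra.
pose y := invmx (s%:M - M) *m v.
have yE : s *: y = M *m y + v.
  have <- : (s%:M - M) *m y = v by rewrite /y mulmxA mulmxV // mul1mx.
  by rewrite solE subrKC.
exists y => //; apply: (min_principle M0 w0 Mw); rewrite yE.
by move=> i j; rewrite [leRHS]mxE lerDl; have := v0 i j; rewrite mxE.
Qed.

End EntrywiseOrder.

(** * Spectral radius of a nonnegative matrix through supersolutions *)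

Section SpectralRadius.
Variable R : realType.
Local Notation normc := (@ComplexField.Normc.normc R).

Lemma ler_normc_sum (I : finType) (F : I -> R[i]) :
  normc (\sum_i F i) <= \sum_i normc (F i).
Proof.
elim/big_ind2: _ => [|x1 x2 y1 y2 ? ?|//]; first by rewrite ComplexField.Normc.normc0.
by apply: le_trans (@le_normcD R _ _) _; apply: lerD.
Qed.

Lemma normc_ge0 (z : R[i]) : 0 <= normc z.
Proof. by case: z => a b; apply: sqrtr_ge0. Qed.

Lemma normc_real (x : R) : normc x%:C%C = `|x|.
Proof. by rewrite /ComplexField.Normc.normc /= expr0n addr0 sqrtr_sqr. Qed.

(* Pairing the moduli of a left eigenvector with a positive supersolution
   (the Collatz-Wielandt bound). *)
Lemma normc_spectrum_le n (M : 'M[R]_n) (s : R) (w : 'cV[R]_n) (z : R[i]) :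
  mx_le 0 M -> mx_lt 0 w -> mx_le (M *m w) (s *: w) ->
  spectrum M z -> normc z <= s.
Proof.
move=> M0 w0 Mw /eigenvalueP[x xM xn0].
have w0' i : 0 < w i 0 by have := w0 i 0; rewrite mxE.
have M0' i j : 0 <= M i j by have := M0 i j; rewrite mxE.
pose xi i := normc (x 0 i).
have xiM j : normc z * xi j <= \sum_i xi i * M i j.
  have -> : normc z * xi j = normc (\sum_i x 0 i * (M i j)%:C%C).
    rewrite -ComplexField.Normc.normcM; congr normc.
    have /rowP/(_ j) := xM; rewrite !mxE => <-.
    by apply: eq_bigr => i _; rewrite !mxE.
  apply: le_trans (ler_normc_sum _) _; apply: ler_sum => i _.
  by rewrite ComplexField.Normc.normcM normc_real ger0_norm.
have xiw : 0 < \sum_j xi j * w j 0.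
  have [j xj] : exists j, x 0 j != 0 by apply/rV0Pn.
  rewrite (bigD1 j) //= ltr_pwDl //.
    rewrite mulr_gt0 // lt_neqAle normc_ge0 andbT eq_sym.
    by apply: contra xj => /eqP/ComplexField.Normc.eq0_normc ->.
  by apply: sumr_ge0 => k _; rewrite mulr_ge0 ?normc_ge0 // ltW.
rewrite -(ler_pM2r xiw) mulr_sumr mulr_sumr.
apply: (@le_trans _ _ (\sum_j (\sum_i xi i * M i j) * w j 0)).
  by apply: ler_sum => j _; rewrite mulrA ler_pM2r.
under eq_bigr do rewrite mulr_suml.
rewrite exchange_big /=; apply: ler_sum => i _.
have := Mw i 0; rewrite !mxE => Mwi.
under eq_bigr do rewrite -mulrA.
by rewrite -mulr_sumr mulrCA ler_wpM2l ?normc_ge0.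
Qed.

Lemma spectral_radius_le n (M : 'M[R]_n) (s : R) (w : 'cV[R]_n) :
  0 <= s -> mx_le 0 M -> mx_lt 0 w -> mx_le (M *m w) (s *: w) ->
  spectral_radius M <= s.
Proof.
move=> s0 M0 w0 Mw; rewrite /spectral_radius; set E := (X in sup X).
have Eub : ubound E s by move=> _ [z Mz <-]; apply: normc_spectrum_le Mz.
(* For an empty spectrum ([n = 0]) [sup] takes its default value 0, and [0 <= s] concludes. *)
have [->|/set0P E0] := eqVneq E set0; first by rewrite sup0.
exact: ge_sup.
Qed.

(** The supersolution bounds the set of moduli, so that its [sup] is a genuine upper bound rather
    than a default value. *)
Lemma real_eigenvalue_le n (M : 'M[R]_n) (s r : R) (w : 'cV[R]_n) :
  mx_le 0 M -> mx_lt 0 w -> mx_le (M *m w) (s *: w) ->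
  eigenvalue M r -> r <= spectral_radius M.
Proof.
move=> M0 w0 Mw Mr; apply: (le_trans (ler_norm r)); rewrite -normc_real.
apply: ub_le_sup; first by exists s => _ [z Mz <-]; apply: normc_spectrum_le Mz.
by exists r%:C%C => //; rewrite /spectrum /= (eigenvalue_map (real_complex R)).
Qed.

Lemma spectral_radius_ge0 n (M : 'M[R]_n) : 0 <= spectral_radius M.
Proof.
rewrite /spectral_radius; set E := (X in sup X).
have [[[x Ex] Eub]|/sup_out -> //] := pselect (has_sup E).
apply: le_trans (ub_le_sup Eub Ex).
by case: Ex => z _ <-; apply: normc_ge0.
Qed.

(** By continuity a negative value at [a] would persist slightly to the right of [a]. *)
Lemma horner_ge0_right (p : {poly R}) (a : R) :
  (forall t, a < t -> 0 <= p.[t]) -> 0 <= p.[a].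
Proof.
move=> p0; rewrite leNgt; apply/negP => pa.
have pa' : 0 < - p.[a] by lra.
have [d d0 /(_ (a + d / 2))] := poly_cont a p pa'.
rewrite (_ : a + d / 2 - a = d / 2); last by ring.
rewrite ger0_norm; last lra.
have adx : a < a + d / 2 by lra.
have := p0 _ adx; set q := p.[_] => q0 /(_ ltac:(lra)).
by rewrite ger0_norm; lra.
Qed.

(* The infimum of the levels admitting a positive strict supersolution cannot
   exceed [s]: there the resolvent exists, is nonnegative by continuity of the
   adjugate, and yields a supersolution at a slightly lower level. *)
Lemma exists_supersolution n (M : 'M[R]_n) (s : R) :
  mx_le 0 M -> (forall r, s <= r -> ~~ eigenvalue M r) ->
  exists2 w : 'cV[R]_n, mx_lt 0 w & mx_lt (M *m w) (s *: w).
Proof.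
move=> M0 Ms; pose o : 'cV[R]_n := const_mx 1.
pose E := [set t : R | s <= t /\
  exists2 w : 'cV[R]_n, mx_lt 0 w & mx_lt (M *m w) (t *: w)].
have o0 : mx_lt 0 o by move=> i j; rewrite !mxE ltr01.
have E0 : E !=set0.
  (* The sum of all entries bounds every row sum, so the all-ones vector works at level [b + 1]. *)
  pose b := \sum_i \sum_j M i j; have M0' i j : 0 <= M i j by have := M0 i j; rewrite mxE.
  exists (Num.max s (b + 1)); split; first by rewrite le_max lexx.
  exists o => // i j; rewrite !mxE mulr1; apply: (@lt_le_trans _ _ (b + 1)).
    apply: (@le_lt_trans _ _ b); last by rewrite ltrDl.
    rewrite /b [leRHS](bigD1 i) //= ler_wpDr ?sumr_ge0 // => [k _|].
      by rewrite sumr_ge0.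
    by apply: ler_sum => k _; rewrite !mxE mulr1.
  by rewrite le_max lexx orbT.
have Elb : has_lbound E by exists s => t [].
pose t0 := inf E; have st0 : s <= t0 by apply: lb_le_inf => // t [].
have Eup t : t0 < t -> E t.
  move=> /(inf_lt E0) [e [se [w w0 Mw]] et]; split; first by apply: le_trans se (ltW et).
  exists w => // i j; apply: lt_trans (Mw i j) _; rewrite !mxE ltr_pM2r //.
  by have := w0 i j; rewrite mxE.
pose C t := t%:M - M.
have Cdet t : s <= t -> \det (C t) != 0.
  move=> /Ms; apply: contra => /det0P[v v0 vC]; apply/eigenvalueP; exists v => //.
  by apply/eqP; rewrite -subr_eq0 -mul_mx_scalar -mulmxBr -opprB mulmxN vC oppr0.
pose x t := (\det (C t))^-1 *: (\adj (C t) *m o).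
have xE t : s <= t -> M *m x t = t *: x t - o.
  move=> st; have : C t *m x t = o.
    by rewrite /x -scalemxAr mulmxA mul_mx_adj mul_scalar_mx scalerA mulVf ?scale1r ?Cdet.
  by rewrite /C mulmxBl mul_scalar_mx => <-; rewrite opprB addrC subrK.
have sub_o t (y : 'cV[R]_n) : mx_lt (t *: y - o) (t *: y).
  by move=> i j; rewrite !mxE ltrBlDr ltrDl ltr01.
(* Multiplying [x t] by the square of the determinant gives a polynomial in [t] of the same sign, to
   which [horner_ge0_right] applies at [t0]. *)
pose px i : {poly R} := (\adj (char_poly_mx M) *m (const_mx 1 : 'cV_n)) i 0 * \det (char_poly_mx M).
have CE t : C t = map_mx (horner_eval t) (char_poly_mx M).
  by apply/matrixP => i j; rewrite !mxE /horner_eval !hornerE hornerMn hornerX.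
have pxE t i : (px i).[t] = (\adj (C t) *m o) i 0 * \det (C t).
  rewrite hornerM CE det_map_mx -map_mx_adj; congr (_ * _).
  rewrite -[LHS]/(horner_eval t _) !mxE rmorph_sum; apply: eq_bigr => k _.
  by rewrite rmorphM !mxE /= [X in _ * X]/horner_eval hornerC.
have xpx t i : s <= t -> (px i).[t] = x t i 0 * (\det (C t)) ^+ 2.
  by move=> st; rewrite pxE [x t i 0]mxE; field; apply: Cdet.
clearbody x.
have x0 : mx_le 0 (x t0).
  move=> i j; rewrite (ord1 j) [X in X <= _]mxE.
  rewrite -(@pmulr_lge0 _ ((\det (C t0)) ^+ 2)); last by rewrite lt0r sqr_ge0 sqrf_eq0 Cdet.
  rewrite -xpx //; apply: horner_ge0_right => t t0t.
  have [st [w w0 Mw]] := Eup t t0t.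
  rewrite xpx // mulr_ge0 ?sqr_ge0 //.
  suff /(_ i 0) : mx_le 0 (x t) by rewrite mxE.
  by apply: (min_principle M0 w0 Mw); rewrite xE //; apply: mx_ltW.
(* A zero entry of [x t0] would make the same entry of [M *m x t0] equal to -1. *)
have x1 : mx_lt 0 (x t0).
  move=> i j; rewrite (ord1 j) [X in X < _]mxE lt_neqAle.
  have xi0 : 0 <= x t0 i 0 by have := x0 i 0; rewrite mxE.
  rewrite xi0 andbT; apply/eqP => xi; have := mulmx_ge0 M0 x0 i 0.
  by rewrite xE // !mxE -[X in t0 * X]xi mulr0 sub0r lerNr oppr0 ler10.
have -> : s = t0.
  apply/eqP; rewrite eq_le st0 leNgt; apply/negP => st.
  have [e e0 eP] := exists_small_scale (fun i => x t0 i 0) (fun _ : 'I_n => ltr01).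
  pose d := Num.min e (t0 - s).
  have d0 : 0 < d by rewrite lt_min e0 subr_gt0.
  have : E (t0 - d).
    split; first by rewrite lerBrDr -lerBrDl ge_min lexx orbT.
    exists (x t0) => // i j; rewrite xE ?ltW // (ord1 j) !mxE.
    have := eP i; have : d <= e by rewrite ge_min lexx.
    have := x1 i 0; rewrite mxE; set u := x t0 i 0.
    nra.
  by move/(ge_inf Elb); rewrite -/t0; lra.
by exists (x t0) => //; rewrite xE.
Qed.

End SpectralRadius.

(** * Projections attached to Moore-Penrose inverses *)

Section MoorePenrose.
Variable R : realType.

Lemma eq_mulmx_cV m n (M N : 'M[R]_(m, n)) :
  (forall x : 'cV[R]_n, M *m x = N *m x) -> M = N.
Proof.
move=> MN; apply/matrixP => i j.
by have := MN (delta_mx j 0); rewrite -!colE => /matrixP/(_ i 0); rewrite !mxE.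
Qed.

(** An orthogonal projection is determined by its null space, or by its range. Here each product of
    the two projections collapses to one factor, and symmetry lets transposition exchange the order
    of the product. *)
Lemma MP_eq_projections m n (A P : 'M[R]_(m, n)) (Ad Pd : 'M[R]_(n, m)) :
  is_MP_inverse A Ad -> is_MP_inverse P Pd ->
  mx_range P = mx_range A -> mx_null P = mx_null A ->
  Pd *m P = Ad *m A /\ P *m Pd = A *m Ad.
Proof.
have null_proj (M N : 'M[R]_(m, n)) (Md : 'M[R]_(n, m)) :
    M *m Md *m M = M -> mx_null M = mx_null N -> N *m (Md *m M) = N.
  move=> MMd MN; apply: eq_mulmx_cV => x.
  have : mx_null N (x - Md *m M *m x).
    rewrite -MN; change (M *m (x - Md *m M *m x) = 0).
    by rewrite mulmxBr !mulmxA MMd subrr.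
  move=> Nx; apply/esym/eqP; rewrite -subr_eq0 -mulmxA -mulmxBr; apply/eqP.
  exact: Nx.
have range_proj (M N : 'M[R]_(m, n)) (Md : 'M[R]_(n, m)) :
    M *m Md *m M = M -> mx_range M = mx_range N -> M *m Md *m N = N.
  move=> MMd MN; apply: eq_mulmx_cV => x.
  have : mx_range M (N *m x) by rewrite MN; exists x.
  by case=> z Nx; rewrite -mulmxA Nx mulmxA MMd.
move=> [A1 _ A3 A4] [P1 _ P3 P4] rPA nPA; split.
- have E1 : Pd *m P *m (Ad *m A) = Pd *m P by rewrite -mulmxA (null_proj A P).
  have E2 : Ad *m A *m (Pd *m P) = Ad *m A by rewrite -mulmxA (null_proj P A).
  by rewrite -P4 -E1 trmx_mul P4 A4.
- have E1 : A *m Ad *m (P *m Pd) = P *m Pd by rewrite mulmxA (range_proj A P).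
  have E2 : P *m Pd *m (A *m Ad) = A *m Ad by rewrite mulmxA (range_proj P A).
  by rewrite -P3 -E1 trmx_mul P3 A3.
Qed.

End MoorePenrose.

(** * Companion block matrices and their quadratic inequality *)

Section Companion.
Variables (R : realType) (n : nat).
Implicit Types (B C : 'M[R]_n) (y : 'cV[R]_n).

Let companion B C : 'M[R]_(n + n) := block_mx B C 1%:M 0.

Lemma companion_ge0 B C : mx_le 0 B -> mx_le 0 C -> mx_le 0 (companion B C).
Proof.
move=> B0 C0 i j; rewrite !mxE; case: split => k; rewrite !mxE; case: split => l.
- by have := B0 k l; rewrite mxE.
- by have := C0 k l; rewrite mxE.
- by rewrite !mxE; case: eqP.
- by rewrite mxE.
Qed.

(** Stacking [t *: y] above [y] turns the lower block row into an equality, and the upper one into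
    the quadratic inequality. *)
Lemma companion_supersolution B C (t : R) y :
  0 < t -> mx_lt 0 y -> mx_le ((t *: B + C) *m y) (t ^+ 2 *: y) ->
  exists2 w : 'cV[R]_(n + n), mx_lt 0 w & mx_le (companion B C *m w) (t *: w).
Proof.
move=> t0 y0 Ky; exists (col_mx (t *: y) y).
  by move=> i j; rewrite !mxE; case: split => k; have := y0 k j; rewrite !mxE // => ?;
    rewrite mulr_gt0.
rewrite mul_block_col scale_col_mx; apply: mx_le_col.
  by rewrite scalerA -expr2 -scalemxAr scalemxAl -mulmxDl.
by rewrite mul1mx mul0mx addr0.
Qed.

Lemma companion_spectral_radius_le B C (t : R) y :
  0 < t -> mx_le 0 B -> mx_le 0 C -> mx_lt 0 y ->
  mx_le ((t *: B + C) *m y) (t ^+ 2 *: y) ->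
  spectral_radius (companion B C) <= t.
Proof.
move=> t0 B0 C0 y0 Ky; have [w w0 Tw] := companion_supersolution t0 y0 Ky.
exact: spectral_radius_le (ltW t0) (companion_ge0 B0 C0) w0 Tw.
Qed.

(** At level [1 - d] the right side loses at most [2 * d * y], which the strict slack absorbs, while
    the left side does not grow because [B] is nonnegative. The bound [d <= 1 / 2] keeps the level
    positive. *)
Lemma companion_level_lt1 B C y :
  mx_le 0 B -> mx_lt 0 y -> mx_lt ((B + C) *m y) y ->
  exists2 t : R, 0 < t < 1 & mx_le ((t *: B + C) *m y) (t ^+ 2 *: y).
Proof.
move=> B0 y0 By.
have y0' i : 0 < y i 0 by have := y0 i 0; rewrite mxE.
have By' i : 0 < y i 0 - ((B + C) *m y) i 0 by rewrite subr_gt0.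
have [e e0 eP] := exists_small_scale (fun i => 2 * y i 0) By'.
pose d := Num.min e (1 / 2); have d0 : 0 < d by rewrite lt_min e0 /=; lra.
have d1 : d <= 1 / 2 by rewrite ge_min lexx orbT.
have de : d <= e by rewrite ge_min lexx.
exists (1 - d); first by lra.
have -> : (1 - d) *: B + C = (B + C) - d *: B by rewrite scalerBl scale1r addrAC.
have dB : mx_le 0 (d *: (B *m y)).
  exact: mx_scaler_ge0 (ltW d0) (mulmx_ge0 B0 (mx_ltW y0)).
have sub (u v : 'cV[R]_n) i : (u - v) i 0 = u i 0 - v i 0 by rewrite !mxE.
have sc (a : R) (u : 'cV[R]_n) i : (a *: u) i 0 = a * u i 0 by rewrite mxE.
move=> i j; rewrite (ord1 j) mulmxBl -scalemxAl sub sc.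
have := dB i 0; have := eP i; have := y0' i.
rewrite !sc [(0 : 'cV_n) i 0]mxE.
set p := ((B + C) *m y) i 0; set q := (B *m y) i 0; set u := y i 0; nra.
Qed.

(** The supersolution at level [s] ensures that the spectral radius dominates the real eigenvalues,
    so none reaches [t]. A strict supersolution [(a, b)] of the block matrix satisfies [a < t b];
    replacing [t C b] by the smaller [C a] in the upper row leaves an inequality in [a] alone. *)
Lemma companion_exists_supersolution B C (s t : R) y :
  mx_le 0 B -> mx_le 0 C -> 0 < s -> mx_lt 0 y ->
  mx_le ((s *: B + C) *m y) (s ^+ 2 *: y) ->
  spectral_radius (companion B C) < t ->
  exists2 a : 'cV[R]_n, mx_lt 0 a & mx_lt ((t *: B + C) *m a) (t ^+ 2 *: a).
Proof.
move=> B0 C0 s0 y0 Ky rt; have T0 := companion_ge0 B0 C0.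
have [w w0 Tw] := companion_supersolution s0 y0 Ky.
have [|z z0 Tz] := @exists_supersolution _ _ _ t T0.
  move=> r tr; apply/negP => /(real_eigenvalue_le T0 w0 Tw).
  by rewrite leNgt (lt_le_trans rt tr).
have t0 : 0 < t by apply: le_lt_trans (spectral_radius_ge0 _) rt.
move: z0 Tz; rewrite -(vsubmxK z); set a := usubmx z; set b := dsubmx z.
rewrite mul_block_col scale_col_mx mul1mx mul0mx addr0 -[X in mx_lt X _]vsubmxK.
move=> /mx_lt_col[a0 _] /mx_lt_col[Bab ab].
exists a; first by move=> i j; have := a0 i j; rewrite !mxE.
move=> i j; apply: (@le_lt_trans _ _ ((t *: (B *m a + C *m b)) i j)).
  have ad (u v : 'cV[R]_n) : (u + v) i j = u i j + v i j by rewrite mxE.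
  rewrite mulmxDl scalerDr -scalemxAl !ad lerD2l scalemxAr.
  by apply: mulmx_le => //; apply: mx_ltW.
rewrite expr2 -scalerA [ltLHS]mxE [ltRHS]mxE ltr_pM2l //; exact: Bab.
Qed.

End Companion.

(** * Comparison of the splittings, with [Q1], [Q2], [Pi] standing for P1^+, P2^+, A^+ A *)

Section Comparison.
Variables (R : realType) (m n : nat).
Variables (A R2 S2 : 'M[R]_(m, n)) (Q1 Q2 Ad : 'M[R]_(n, m)).
Variables (B1 C1 Pi : 'M[R]_n).
Let B2 := Q2 *m R2.
Let C2 := - (Q2 *m S2).
Let o : 'cV[R]_m := const_mx 1.
Hypotheses (Q1_ge0 : mx_le 0 Q1) (Q12 : mx_le Q1 Q2) (Ad_ge0 : mx_le 0 Ad).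
Hypotheses (B1_ge0 : mx_le 0 B1) (C1_ge0 : mx_le 0 C1) (B12 : mx_le B1 B2).
Hypotheses (R2_ge0 : mx_le 0 R2) (S2_le0 : mx_le S2 0).
Hypotheses (Q1A : Q1 *m A = Pi - B1 - C1) (Q2A : Q2 *m A = Pi - B2 - C2).
Hypotheses (PiQ2 : Pi *m Q2 = Q2) (PiAd : Pi *m Ad = Ad).
Hypotheses (Q2AAd : Q2 *m A *m Ad = Q2).
(** It holds for the splittings because P1^+ = P1^+ P2 P2^+, so that P1^+ factors through P2^+. *)
Hypothesis Q21 : forall (y : 'cV[R]_n) (k : 'cV[R]_m),
  Q2 *m A *m y = Q2 *m k -> Q1 *m A *m y = Q1 *m k.

Let Q2_ge0 : mx_le 0 Q2 := mx_le_trans Q1_ge0 Q12.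
Let o_ge0 : mx_le 0 o. Proof. by move=> i j; rewrite !mxE ler01. Qed.
Let nS2_ge0 : mx_le 0 (- S2) := mx_oppr_ge0 S2_le0.
Let B2_ge0 : mx_le 0 B2 := mulmx_ge0 Q2_ge0 R2_ge0.
Let C2E : C2 = Q2 *m (- S2). Proof. by rewrite mulmxN. Qed.
Let C2_ge0 : mx_le 0 C2. Proof. by rewrite C2E; apply: mulmx_ge0. Qed.

Let adE p (u v : 'cV[R]_p) i : (u + v) i 0 = u i 0 + v i 0.
Proof. by rewrite mxE. Qed.
Let opE p (u : 'cV[R]_p) i : (- u) i 0 = - u i 0.
Proof. by rewrite mxE. Qed.
Let scE p (a : R) (u : 'cV[R]_p) i : (a *: u) i 0 = a * u i 0.
Proof. by rewrite mxE. Qed.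
Let ge0E p (u : 'cV[R]_p) i : mx_le 0 u -> 0 <= u i 0.
Proof. by move=> /(_ i 0); rewrite mxE. Qed.
Let KE (t : R) (B C : 'M[R]_n) (y : 'cV[R]_n) :
  (t *: B + C) *m y = t *: (B *m y) + C *m y.
Proof. by rewrite mulmxDl scalemxAl. Qed.
Let K_ge0 (t : R) (B C : 'M[R]_n) :
  0 <= t -> mx_le 0 B -> mx_le 0 C -> mx_le 0 (t *: B + C).
Proof. by move=> t0 B0 C0; apply: mx_addr_ge0 => //; apply: mx_scaler_ge0. Qed.
Let K2E (t : R) : t *: B2 + C2 = Q2 *m (t *: R2 - S2).
Proof. by rewrite mulmxBr -scalemxAr. Qed.

(** The source [Q2 *m o] is positive in each nonzero row of [Q2]; in the other rows [B2] and [C2]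
    vanish too. Strictness is therefore available wherever it matters. *)
Let solves (t : R) (y : 'cV[R]_n) : Prop :=
  mx_le 0 y /\ t ^+ 2 *: y = (t *: B2 + C2) *m y + Q2 *m o.

(* [A y] is nonnegative modulo the null space of [Q2]. *)
Lemma solves_residual (t : R) y : 0 < t <= 1 -> solves t y ->
  exists2 k, mx_le 0 k & Q2 *m A *m y = Q2 *m k.
Proof.
move=> t01 [y0 yE].
pose h := t ^- 2 *: ((t *: R2 - S2) *m y + o).
have t2 : t ^+ 2 != 0 by apply: expf_neq0; lra.
have yh : y = Q2 *m h.
  by rewrite /h -scalemxAr mulmxDr mulmxA -K2E -yE scalerA mulVf // scale1r.
have h0 : mx_le 0 h.
  apply: mx_scaler_ge0; first by rewrite invr_ge0 sqr_ge0.
  apply: mx_addr_ge0 => //; apply: mulmx_ge0 => //; apply: mx_addr_ge0 => //.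
  by apply: mx_scaler_ge0 => //; lra.
(* Eliminating [B2 *m y] from [y - B2 y - C2 y] by the equation for [y] leaves
   [(1 - t) (y + (C2 y + v) / t) + v] with [v = Q2 *m o]; each term lifts through [Q2]. *)
exists ((1 - t) *: (h + t^-1 *: ((- S2) *m y + o)) + o).
  apply: mx_addr_ge0 => //; apply: mx_scaler_ge0; first lra.
  apply: mx_addr_ge0 => //; apply: mx_scaler_ge0; first by rewrite invr_ge0; lra.
  by apply: mx_addr_ge0 => //; apply: mulmx_ge0.
have Piy : Pi *m y = y by rewrite yh mulmxA PiQ2.
rewrite Q2A !mulmxBl Piy mulmxDr -scalemxAr mulmxDr -yh -scalemxAr mulmxDr mulmxA -C2E.
apply/colP => i; have /colP/(_ i) := yE.
rewrite KE !(adE, opE, scE).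
set yi := y i 0; set b := (B2 *m y) i 0; set c := (C2 *m y) i 0; set v := (_ *m o) i 0.
move=> E; have -> : b = (t ^+ 2 * yi - c - v) / t by rewrite E; field; lra.
by field; lra.
Qed.

(** From [Q1 k <= Q2 k] one gets [B2 y + C2 y <= B1 y + C1 y]. Subtracting [(1 - t) B2 y] on the
    left and the smaller [(1 - t) B1 y] on the right preserves it. *)
Lemma solves_bound (t : R) y : 0 < t <= 1 -> solves t y ->
  mx_le (t ^+ 2 *: y) ((t *: B1 + C1) *m y + Q2 *m o).
Proof.
move=> t01 sy; have [y0 yE] := sy; have [k k0 Q2k] := solves_residual t01 sy.
have Q1k := Q21 Q2k; rewrite yE !KE => i j; rewrite (ord1 j).
have Q12k : (Q1 *m k) i 0 <= (Q2 *m k) i 0 by apply: mulmx_le_r.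
have B12y : (B1 *m y) i 0 <= (B2 *m y) i 0 by apply: mulmx_le_r.
move: Q2k Q1k; rewrite Q1A Q2A !mulmxBl => /colP/(_ i) + /colP/(_ i).
rewrite !(adE, opE, scE).
move: Q12k B12y; set b1 := (B1 *m y) i 0; set b2 := (B2 *m y) i 0; nra.
Qed.

Lemma solves_start : solves 1 (Ad *m o).
Proof.
split; first exact: mulmx_ge0.
rewrite expr1n KE !scale1r -[in Q2 *m o]Q2AAd Q2A -mulmxA.
rewrite !mulmxBl [Pi *m _]mulmxA PiAd; apply/colP => i.
by rewrite !(adE, opE); ring.
Qed.

Variable (l : R) (a : 'cV[R]_n).
Hypotheses (l01 : 0 < l <= 1) (a_gt0 : mx_lt 0 a).
Let l_gt0 : 0 < l. Proof. by case/andP: l01. Qed.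
Hypothesis Ka : mx_lt ((l *: B1 + C1) *m a) (l ^+ 2 *: a).

(* [t a - C1 a / t - B1 a] increases with [t]. *)
Let slack_mono (t : R) i : l <= t ->
  (l ^+ 2 *: a) i 0 - ((l *: B1 + C1) *m a) i 0 <=
  (t ^+ 2 *: a) i 0 - ((t *: B1 + C1) *m a) i 0.
Proof.
move=> lt; have := Ka i 0; rewrite !KE !(adE, scE).
have := ge0E i (mulmx_ge0 C1_ge0 (mx_ltW a_gt0)); have := ge0E i (mx_ltW a_gt0).
set b := (B1 *m a) i 0; set c := (C1 *m a) i 0; set x := a i 0 => x0 c0 h.
have bx : b < l * x by rewrite -(ltr_pM2l l_gt0); lra.
have tl0 : 0 <= t - l by lra.
have : 0 <= (t - l) * ((t + l) * x - b).
  by apply: mulr_ge0 => //; have := mulr_ge0 tl0 x0; have := mulr_ge0 (ltW l_gt0) x0; lra.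
lra.
Qed.

Let Ka_above (t : R) : l <= t -> mx_lt ((t *: B1 + C1) *m a) (t ^+ 2 *: a).
Proof.
by move=> lt i j; rewrite (ord1 j); have := slack_mono i lt; have := Ka i 0; lra.
Qed.

(** A large multiple of [a] has slack above [Q2 *m o] at level [l], hence at every level up to 1 by
    [slack_mono]. The minimum principle applied to its difference with [y] gives a bound independent
    of [t] and [y]. *)
Lemma solves_uniform_bound :
  exists Y : 'cV[R]_n, forall t y, l <= t <= 1 -> solves t y -> mx_le y Y.
Proof.
pose d i := (l ^+ 2 *: a) i 0 - ((l *: B1 + C1) *m a) i 0.
have d0 i : 0 < d i by rewrite subr_gt0; apply: Ka.
have [e e0 eP] := exists_small_scale (fun i => (Q2 *m o) i 0) d0.
exists (e^-1 *: a) => t y /andP[lt t1] sy; have t01 : 0 < t <= 1 by have := l01; lra.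
apply/mx_subr_ge0.
have K10 : mx_le 0 (t *: B1 + C1) by apply: K_ge0 => //; lra.
apply: (min_principle K10 a_gt0 (Ka_above lt)).
move=> i j; rewrite (ord1 j) mulmxBr -scalemxAr !(adE, opE, scE).
have := solves_bound t01 sy i 0; have := eP i; have := slack_mono i lt.
rewrite /d [(t ^+ 2 *: a) i 0]scE !(adE, scE).
set p := (_ *m a) i 0; set q := (_ *m a) i 0; set v := (_ *m o) i 0 => h ev yv.
have : v <= e^-1 * (t ^+ 2 * a i 0 - q).
  by rewrite mulrC ler_pdivlMr // mulrC; apply: le_trans (ltW ev) h.
lra.
Qed.

(** The solution at [t] is itself a strict supersolution at a nearby [t']: the source outweighs the
    loss [(t ^+ 2 - t' ^+ 2) y], at most [2 * d * Y]. As [Y] is uniform, the step length [d] does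
    not depend on [t]. *)
Lemma solves_step : exists2 d : R, 0 < d &
  forall t t' y, l <= t' -> t' <= t -> t - t' <= d -> t <= 1 -> solves t y ->
  exists y', solves t' y'.
Proof.
have [Y YP] := solves_uniform_bound.
pose v := Q2 *m o; have v0 : mx_le 0 v by apply: mulmx_ge0.
pose f i := if v i 0 == 0 then 1 else v i 0.
have f0 i : 0 < f i.
  by rewrite /f; case: eqP => // /eqP vi; rewrite lt_neqAle eq_sym vi ge0E.
have [d d0 dP] := exists_small_scale (fun i => 2 * Y i 0) f0.
exists d => // t t' y lt' t't tt' t1 sy; have [y0 yE] := sy.
have yY : mx_le y Y by apply: YP sy; lra.
have K20 : mx_le 0 (t' *: B2 + C2) by apply: K_ge0 => //; have := l01; lra.
have [|i|w w0 Kw] := exists_pos_supersolution K20 (_ : 0 < t' ^+ 2) y0.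
- by rewrite exprn_gt0 //; have := l01; lra.
- case: (row0_or_pos i (t' *: R2 - S2) Q2_ge0) => [vi|]; last by rewrite K2E; right.
  left; have := dP i; rewrite /f -/v gt_eqF //.
  have /colP/(_ i) := yE; have := yY i 0; have := ge0E i y0.
  have := ge0E i (mulmx_ge0 B2_ge0 y0); rewrite !KE !(adE, scE).
  set yi := y i 0; set b := (B2 *m y) i 0; set c := (C2 *m y) i 0; set x := Y i 0.
  rewrite -/v; set vi' := v i 0.
  have : (t - t') * (t + t') <= 2 * d by have := l01; nra.
  have : 0 <= (t - t') by lra.
  move=> tt0 tt2 b0 yi0 yx E dx.
  have : (t - t') * (t + t') * yi <= 2 * d * x by have := l01; nra.
  have : 0 <= (t - t') * b by apply: mulr_ge0.
  nra.
have [y' y'0 y'E] := resolvent_solution K20 w0 Kw v0.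
by exists y'.
Qed.

(** Finitely many steps of the fixed length [d] lead from 1 down to [l]; [Num.max] stops the descent
    at [l]. *)
Lemma solves_exists : exists y, solves l y.
Proof.
have [d d0 dP] := solves_step.
have sol k : exists y, solves (Num.max l (1 - k%:R * d)) y.
  elim: k => [|k [y sy]].
    exists (Ad *m o); rewrite mul0r subr0 max_r; [exact: solves_start | by have := l01; lra].
  have kd : 0 <= k%:R * d by rewrite mulr_ge0 // ltW.
  have kS : k.+1%:R * d = k%:R * d + d by rewrite -natr1 mulrDl mul1r.
  have l1 : l <= 1 by case/andP: l01.
  by apply: dP sy; rewrite ?kS; case: (leP l (1 - k%:R * d)) => ?;
    case: (leP l (1 - (k%:R * d + d))) => ?; lra.
have [k kP] : exists k, 1 - k%:R * d <= l.
  have di : 0 < d^-1 by rewrite invr_gt0.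
  have := archi_boundP (ltW di); set k := Num.bound _ => dk; exists k.
  have : d^-1 * d < k%:R * d by rewrite ltr_pM2r.
  by rewrite mulVf ?gt_eqF //; have := l_gt0; lra.
by have := sol k; rewrite max_l.
Qed.

(** Since [l B1 y + C1 y <= y], the left side at a solution [y] is at most [l B2 y + C2 y], that is
    [l ^+ 2 y] minus the source. The whole operator factors through [Q2], so rows without strictness
    are zero and [y] can be made positive. *)
Lemma alternating_supersolution : exists2 y : 'cV[R]_n, mx_lt 0 y &
  mx_le ((l *: (B2 + C2 *m B1) + C2 *m C1) *m y) (l ^+ 2 *: y).
Proof.
have [y sy] := solves_exists; have [y0 yE] := sy.
have [k k0 /Q21 Q1k] := solves_residual l01 sy.
have Piy : Pi *m y = y.
  suff -> : y = l ^- 2 *: (Q2 *m ((l *: R2 - S2) *m y + o)).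
    by rewrite -scalemxAr mulmxA PiQ2.
  by rewrite mulmxDr mulmxA -K2E -yE scalerA mulVf ?scale1r // expf_neq0 //; have := l01; lra.
have K1y : mx_le ((l *: B1 + C1) *m y) y.
  move=> i j; rewrite (ord1 j) KE; move: Q1k; rewrite Q1A !mulmxBl Piy => /colP/(_ i).
  rewrite !(adE, opE, scE); have := ge0E i (mulmx_ge0 Q1_ge0 k0).
  by have := ge0E i (mulmx_ge0 B1_ge0 y0); have := l01; nra.
have KE' : l *: (B2 + C2 *m B1) + C2 *m C1 = Q2 *m (l *: R2 - S2 *m (l *: B1 + C1)).
  rewrite mulmxBr mulmxDr scalerDr -!scalemxAr mulmxDr /C2 !mulNmx scalerN -!mulmxA.
  by rewrite -/B2 -scalemxAr opprD addrA.
have K0 : mx_le 0 (l *: (B2 + C2 *m B1) + C2 *m C1).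
  apply: K_ge0; [have := l01; lra | | exact: mulmx_ge0].
  by apply: mx_addr_ge0 => //; apply: mulmx_ge0.
have [|i|w w0 Kw] := exists_pos_supersolution K0 (_ : 0 < l ^+ 2) y0.
- by rewrite exprn_gt0 //; have := l01; lra.
- rewrite KE'; case: (row0_or_pos i (l *: R2 - S2 *m (l *: B1 + C1)) Q2_ge0) => [vi|];
    last by right.
  left; rewrite -KE' scalerDr -addrA [l *: (C2 *m B1)]scalemxAr -mulmxDr mulmxDl -scalemxAl -mulmxA.
  have := mulmx_le C2_ge0 K1y i 0; have /colP/(_ i) := yE.
  rewrite [in X in X -> _]KE !(adE, scE); move: vi; rewrite -/o; lra.
by exists w => //; apply: mx_ltW.
Qed.

End Comparison.

Theorem theorem3p8 (R : realType) (m n : nat) (A : 'M[R]_(m, n)) (Ad : 'M[R]_(n, m))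
  (P1 R1 S1 P2 R2 S2 : 'M[R]_(m, n)) (P1d P2d : 'M[R]_(n, m))
  (Ahd : 'M[R]_(n, m)) :
  is_MP_inverse A Ad -> mx_le 0 Ad ->
  double_proper_weak_regular A P1 R1 S1 P1d ->
  double_proper_regular A P2 R2 S2 P2d ->
  mx_null P2 `<=` mx_null S2 ->
  mx_range S2 `<=` mx_range P2 ->
  ~ spectrum (S2 *m P1d) (1%:C)%C ->
  is_MP_inverse ((1%:M - S2 *m P1d) *m A) Ahd -> mx_le 0 Ahd ->
  mx_le P1d P2d ->
  mx_le (P1d *m R1) (P2d *m R2) ->
  let W12 : 'M[R]_(n + n) :=
    block_mx (P2d *m R2 - P2d *m S2 *m P1d *m R1) (P2d *m S2 *m P1d *m S1)
             1%:M 0 in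
  let T1 : 'M[R]_(n + n) :=
    block_mx (P1d *m R1) (- (P1d *m S1)) 1%:M 0 in
  spectral_radius W12 <= spectral_radius T1 /\ spectral_radius T1 < 1.
Proof.
move=> MPA Ad0 [[A1 [r1 n1]] MP1 Q10 B10 /mx_oppr_ge0 C10].
move=> [[A2 [r2 n2]] MP2 Q20 R20 S20] _ _ _ _ _ Q12 B12 W12 T1.
have [p1 q1] := MP_eq_projections MPA MP1 r1 n1.
have [p2 q2] := MP_eq_projections MPA MP2 r2 n2.
have [_ AdAAd _ _] := MPA; have [_ P1dP _ _] := MP1; have [_ P2dP _ _] := MP2.
set B1 := P1d *m R1; set C1 := - (P1d *m S1).
set B2 := P2d *m R2; set C2 := - (P2d *m S2).
have Q1A : P1d *m A = Ad *m A - B1 - C1.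
  by rewrite {1}A1 mulmxDr mulmxBr p1 opprK.
have Q2A : P2d *m A = Ad *m A - B2 - C2.
  by rewrite {1}A2 mulmxDr mulmxBr p2 opprK.
have Q1AAd : P1d *m A *m Ad = P1d by rewrite -mulmxA -q1 mulmxA.
have Q2AAd : P2d *m A *m Ad = P2d by rewrite -mulmxA -q2 mulmxA.
have PiQ2 : Ad *m A *m P2d = P2d by rewrite -p2.
have Q21 (y : 'cV[R]_n) (k : 'cV[R]_m) :
    P2d *m A *m y = P2d *m k -> P1d *m A *m y = P1d *m k.
  move=> Q2k; have QPQ : P1d *m P2 *m P2d = P1d by rewrite -mulmxA q2 mulmxA.
  by rewrite -QPQ -!mulmxA [P2d *m (A *m y)]mulmxA Q2k.
(* The signs cancel, which puts [W12] in companion form with nonnegative blocks. *)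
have W12E : W12 = block_mx (B2 + C2 *m B1) (C2 *m C1) 1%:M 0.
  by rewrite /W12 /B1 /C1 /C2 mulmxN !mulNmx opprK !mulmxA.
have C20 : mx_le 0 C2 by rewrite /C2 -mulmxN; apply: mulmx_ge0 (mx_oppr_ge0 S20).
(* With [x = Ad *m o] one has [(B1 + C1) x = x - P1d *m o], strictly below [x] in every row where
   [P1d] is nonzero; elsewhere [B1 + C1] has a zero row. *)
have [t0 /andP[t00 t01] [y0 y00 Ky0]] : exists2 t : R, 0 < t < 1 &
    exists2 y : 'cV[R]_n, mx_lt 0 y & mx_le ((t *: B1 + C1) *m y) (t ^+ 2 *: y).
  pose o : 'cV[R]_m := const_mx 1.
  have x0 : mx_le 0 (Ad *m o) by apply: mulmx_ge0 => // i j; rewrite !mxE ler01.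
  have BC0 : mx_le 0 (B1 + C1) by apply: mx_addr_ge0.
  have BCx : (B1 + C1) *m (Ad *m o) = Ad *m o - P1d *m o.
    have -> : B1 + C1 = Ad *m A - P1d *m A by rewrite Q1A -addrA -opprD subKr.
    by rewrite mulmxBl !mulmxA AdAAd Q1AAd.
  have [i|y y0] := exists_pos_supersolution BC0 ltr01 x0.
    have -> : B1 + C1 = P1d *m (R1 - S1) by rewrite mulmxBr.
    case: (row0_or_pos i (R1 - S1) Q10) => [oi|]; [left|by right].
    rewrite mulmxBr BCx mul1r [ltLHS]mxE gtrDl [ltLHS]mxE oppr_lt0; exact: oi.
  rewrite scale1r => By; have [t t01 Ky] := companion_level_lt1 B10 y0 By.
  by exists t => //; exists y.
have T1_lt1 : spectral_radius T1 < 1.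
  exact: le_lt_trans (companion_spectral_radius_le t00 B10 C10 y00 Ky0) t01.
split; last exact: T1_lt1.
rewrite leNgt; apply/negP => TW.
(* A level strictly between the two radii and below 1 will be shown to bound the radius of [W12], a
   contradiction. *)
have [t Tt [tW t1]] : exists2 t, spectral_radius T1 < t & t < spectral_radius W12 /\ t < 1.
  move: TW T1_lt1; move: (spectral_radius T1) (spectral_radius W12) => r w rw r_lt1.
  exists ((r + Num.min w 1) / 2); first by case: (leP w 1) => ?; lra.
  by split; case: (leP w 1) => ?; lra.
have t_gt0 : 0 < t by apply: le_lt_trans (spectral_radius_ge0 _) Tt.
have t_01 : 0 < t <= 1 by rewrite t_gt0 ltW.
have [a a0 Ka] := companion_exists_supersolution B10 C10 t00 y00 Ky0 Tt.
have [y y_0 Ky] := alternating_supersolution Q10 Q12 Ad0 B10 C10 B12 R20 S20 Q1A Q2A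
  PiQ2 AdAAd Q2AAd Q21 t_01 a0 Ka.
move: tW; rewrite ltNge W12E => /negP; apply.
apply: companion_spectral_radius_le y_0 Ky => //; last exact: mulmx_ge0.
by apply: mx_addr_ge0; apply: mulmx_ge0.
Qed.
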